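(* Let $(X,\mathcal{U})$ be a complete uniform space, equipped with its uniform topology. If one of the following conditions is satisfied, then $X$ is a Baire space: (1) $(X,\mathcal{U})$ admits a countable base of uniformity; (2) $(X,\mathcal{U})$ is totally bounded.
   Context: A uniform structure (uniformity) on a nonempty set $X$ is a filter $\mathcal{U}$ on $X\times X$, whose elements are called entourages, such that: every $U\in\mathcal{U}$ contains the diagonal $\Delta=\{(x,x):x\in X\}$; if $U\in\mathcal{U}$ then $U^{-1}=\{(y,x):(x,y)\in U\}\in\mathcal{U}$; and for each $U\in\mathcal{U}$ there is $V\in\mathcal{U}$ with $V\circ V\subset U$, where $V\circ V=\{(x,y):\exists z\in X,\ (x,z)\in V,\ (z,y)\in V\}$. A uniform space is not assumed to be separated (Hausdorff). For $U\in\mathcal{U}$ and $x\in X$ put $U[x]=\{y\in X:(x,y)\in U\}$. The uniform topology $\mathcal{T}_{\mathcal{U}}$ on $X$ is the one in which $A\subset X$ is open if and only if for each $x\in A$ there is $U\in\mathcal{U}$ with $U[x]\subset A$; topological properties of a uniform space refer to this topology. A base of uniformity is a subfamily $\mathcal{B}\subset\mathcal{U}$ that is a filter base of $\mathcal{U}$ (every $U\in\mathcal{U}$ contains some $B\in\mathcal{B}$). A prefilter (filter base) $\mathcal{B}$ in $X$ is Cauchy if for every $U\in\mathcal{U}$ there is $B\in\mathcal{B}$ with $B\times B\subset U$; it converges to $x\in X$ if every neighborhood of $x$ belongs to the filter generated by $\mathcal{B}$. $(X,\mathcal{U})$ is complete if every Cauchy prefilter converges to some point of $X$ (equivalently, every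 Cauchy net converges). $(X,\mathcal{U})$ is totally bounded if for each $U\in\mathcal{U}$ there is a finite covering $C$ of $X$ such that $T\times T\subset U$ for each $T\in C$. A topological space is a Baire space if every countable intersection of dense open sets is dense. *)

(* Defs.v *)
From mathcomp Require Import all_boot all_classical topology.

Set Implicit Arguments.
Unset Strict Implicit.
Unset Printing Implicit Defensive.

Local Open Scope classical_set_scope.

Definition totally_bounded (X : uniformType) : Prop :=
  forall U : set (X * X), entourage U ->
    exists C : set (set X), [/\ finite_set C,
      \bigcup_(T in C) T = [set: X] &
      forall T, C T -> T `*` T `<=` U].

(* [countable] includes finite families; the empty family has intersection
   [setT]. *)
Definition Baire_space (X : topologicalType) : Prop :=
  forall G : set (set X), countable G ->
    (forall A, G A -> open A /\ dense A) ->
    dense (\bigcap_(A in G) A).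

(* Main.v *)
Require Import Defs.
From mathcomp Require Import all_boot all_classical topology.
From mathcomp Require Import finmap.

(** Given dense open sets [A n], choose nonempty open sets [W n] inside a
  prescribed one with [closure (W n.+1) `<=` A n `&` W n], and let [F] be an
  ultrafilter containing all of them.  When [F] is Cauchy, its limit lies in
  the closure of every [W n], hence in every [A n].  With a countable base, [F]
  is Cauchy because [W n.+1] can be taken small of order the [n]-th basic
  entourage; in a totally bounded space every ultrafilter is Cauchy. *)

Set Implicit Arguments.
Unset Strict Implicit.
Unset Printing Implicit Defensive.

Local Open Scope classical_set_scope.

(** Index by the fibres of an injection [f] from [G] to [nat]: a fibre holds at most one set, and an
    empty fibre has intersection [setT], so an empty [G] is covered too. *)
Lemma countable_bigcap_seq (T : Type) (G : set (set T)) : countable G ->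
  exists A : nat -> set T,
    (forall n, A n = setT \/ G (A n)) /\ \bigcap_n A n `<=` \bigcap_(B in G) B.
Proof.
move=> /countable_injP[f finj].
exists (fun n => \bigcap_(B in [set B | G B /\ f B = n]) B); split.
  move=> n; have [[B [GB fB]]|noB] := pselect (exists B, G B /\ f B = n).
    right; suff -> : [set C | G C /\ f C = n] = [set B] by rewrite bigcap_set1.
    apply/seteqP; split=> [C [GC fC]|_ ->] //=.
    by apply: finj; [exact: mem_set|exact: mem_set|rewrite fC fB].
  by left; apply/seteqP; split=> // x _ B GB; case: noB; exists B.
by move=> x Ax B GB; exact: (Ax (f B)).
Qed.

(** Otherwise [F] would contain the complement of every member of [C], hence their finite
    intersection, which is empty because [C] covers. *)
Lemma ultra_finite_cover (T : Type) (F : set_system T) (C : set (set T)) :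
  UltraFilter F -> finite_set C -> \bigcup_(A in C) A = [set: T] ->
  exists2 A, C A & F A.
Proof.
move=> FU /finite_fsetP[D ->] cover.
have [//|noA] := pselect (exists2 A, [set` D] A & F A).
have /filter_ex[x Dx] : F (\bigcap_(A in [set` D]) ~` A).
  apply: filter_bigI => A DA.
  by have [FA|//] := in_ultra_setVsetC A FU; case: noA; exists A.
have [A DA Ax] : (\bigcup_(A in [set` D]) A) x by rewrite cover.
by case: (Dx A DA).
Qed.

Lemma small_cauchy (X : uniformType) (F : set_system X) :
  (forall U, entourage U -> exists2 A, F A & A `*` A `<=` U) -> cauchy F.
Proof. by move=> small U /small[A FA AU]; exists (A, A). Qed.

Lemma totally_bounded_ultra_cauchy (X : uniformType) (F : set_system X) :
  totally_bounded X -> UltraFilter F -> cauchy F.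
Proof.
move=> tb FU; apply: small_cauchy => U /tb[C [Cfin cover small]].
have [A CA FA] := ultra_finite_cover FU Cfin cover.
by exists A => //; exact: small.
Qed.

(** Density gives a point of [A] in [W]; regularity of uniform spaces controls the closure around
    it. *)
Lemma shrink_open (X : puniformType) (V : set (X * X)) (A W : set X) :
  entourage V -> open A -> dense A -> open W -> W !=set0 ->
  exists W', [/\ open W', W' !=set0, closure W' `<=` A `&` W
    & W' `*` W' `<=` V].
Proof.
move=> entV oA dA oW W0.
have [x [Wx Ax]] := dA W W0 oW.
have xAW : nbhs x (A `&` W) by apply: open_nbhs_nbhs; split; [exact: openI|].
have [B xB BAW] := uniform_regular xAW.
(* As a convergent filter, [nbhs x] is Cauchy: it has members [P] and [Q] with product inside [V],
   so [P]&[Q] is [V]-small. *)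
have cx : cauchy (nbhs x) by apply: cvg_cauchy; apply/cvg_ex; exists x.
have [[P Q] /= [xP xQ] PQV] := cx V entV.
exists (B `&` (P `&` Q))°; split.
- exact: open_interior.
- by exists x; apply: filterI => //; exact: filterI.
- apply: subset_trans BAW; apply: closureS.
  by apply: subset_trans (@interior_subset _ _) _ => y [].
- move=> [y z] /= [/interior_subset[_ [Py _]] /interior_subset[_ [_ Qz]]].
  exact: PQV.
Qed.

Lemma shrinking_open_seq (X : puniformType) (V : nat -> set (X * X))
    (A : nat -> set X) (O : set X) :
  (forall n, entourage (V n)) -> (forall n, open (A n) /\ dense (A n)) ->
  open O -> O !=set0 ->
  exists W : nat -> set X, [/\ W 0 = O, forall n, W n !=set0,
    forall n, closure (W n.+1) `<=` A n `&` W n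
    & forall n, W n.+1 `*` W n.+1 `<=` V n].
Proof.
move=> entV odA oO O0.
pose good (W : set X) := open W /\ W !=set0.
pose next n (W W' : set X) :=
  closure W' `<=` A n `&` W /\ W' `*` W' `<=` V n.
(* Putting [good W] under the existential lets [choice] return a total function; a bad [W] gets
   itself as a dummy value. *)
have step n W : exists W', good W -> good W' /\ next n W W'.
  have [[oW W0]|nW] := pselect (good W); last by exists W.
  have [oA dA] := odA n.
  by have [W' [? ? ? ?]] := shrink_open (entV n) oA dA oW W0; exists W'.
have [f fP] := choice (fun nW : nat * set X => step nW.1 nW.2).
pose W := fix W n := if n is m.+1 then f (m, W m) else O.
have gW n : good (W n) by elim: n => [//|n IH]; exact: (fP (n, W n) IH).1.
have nW n : next n (W n) (W n.+1) by exact: (fP (n, W n) (gW n)).2.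
by exists W; split=> // n; [have [] := gW n|have [] := nW n|have [] := nW n].
Qed.

(** [W (m + n)] lies in both [W m] and [W n], so the sets form a base of a proper filter, which
    extends to an ultrafilter. *)
Lemma nonincreasing_ultra (T : Type) (W : nat -> set T) :
  (forall n, W n !=set0) -> (forall n, W n.+1 `<=` W n) ->
  exists2 F : set_system T, UltraFilter F & forall n, F (W n).
Proof.
move=> W0 WS.
have Wle m n : W (m + n) `<=` W m.
  by elim: n => [|n IH]; rewrite ?addn0 ?addnS //; exact: subset_trans IH.
have WF : ProperFilter (filter_from [set: nat] W).
  apply: filter_from_proper; last by move=> n _; exact: W0.
  apply: filter_from_filter; first by exists 0.
  move=> m n _ _; exists (m + n) => // x Wx; split; first exact: Wle Wx.
  by move: Wx; rewrite addnC; exact: Wle.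
have [F [FU WleF]] := ultraFilterLemma WF.
by exists F => // n; apply: WleF; exists n.
Qed.

Lemma cvg_closure (T : topologicalType) (F : set_system T) (x : T) (A : set T) :
  ProperFilter F -> F --> x -> F A -> closure A x.
Proof.
move=> FF Fx FA B xB; have FAB : F (A `&` B) by apply: filterI => //; exact: Fx.
exact: filter_ex FAB.
Qed.

(** Common form of both cases: the second hypothesis isolates what makes the ultrafilter built from
    the [W n] Cauchy. *)
Lemma complete_ultra_cauchy_Baire (X : completeType) (V : nat -> set (X * X)) :
  (forall n, entourage (V n)) ->
  (forall F : set_system X, UltraFilter F ->
    (forall n, exists2 A, F A & A `*` A `<=` V n) -> cauchy F) ->
  Baire_space X.
Proof.
move=> entV cauchyV G Gcount Gdense O O0 oO.
have [A [AG Acap]] := countable_bigcap_seq Gcount.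
have odA n : open (A n) /\ dense (A n).
  have [->|/Gdense//] := AG n.
  by split; [exact: openT|move=> B B0 _; rewrite setIT].
have [W [W00 W0 Wcl WV]] := shrinking_open_seq entV odA oO O0.
have WS n : W n.+1 `<=` W n.
  by move=> x /(@subset_closure _ (W n.+1)) /Wcl[].
have [F FU FW] := nonincreasing_ultra W0 WS.
have cF : cauchy F by apply: cauchyV => // n; exists (W n.+1).
have /cvg_ex[x Fx] : cvg F by exact: cauchy_cvg.
have xAW n : (A n `&` W n) x.
  by apply: Wcl; exact: cvg_closure (FW n.+1).
exists x; split; first by rewrite -W00; have [] := xAW 0.
by apply: Acap => n _; have [] := xAW n.
Qed.

Theorem theorem4p10 (X : completeType) :
  countable_uniformity X \/ totally_bounded X -> Baire_space X.
Proof.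
move=> [/countable_uniformityP[V Vbase entV]|tb].
- apply: (complete_ultra_cauchy_Baire entV) => F _ small.
  apply: small_cauchy => U /Vbase[n VU].
  by have [A FA AV] := small n; exists A => //; exact: subset_trans VU.
(* Total boundedness makes every ultrafilter Cauchy, so the trivial entourage can serve as each
   [V n]. *)
- apply: (@complete_ultra_cauchy_Baire _ (fun=> setT)) => [n|F FU _].
    exact: entourageT.
  exact: totally_bounded_ultra_cauchy.
Qed.
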